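(* Let Assumption 1 (regularity) and Assumption 2 (Riccati condition), both stated in the context, hold for the two-player constrained linear-quadratic difference game described in the context, and let $\mathbf u^1\in\mathsf U_1$ be a fixed leader announcement. Then $\mathbf u^2\mapsto J_2(\mathbf u^1,\mathbf u^2)$ is strictly convex on $\mathbb R^{Km_2}$, and the follower's reaction set $\mathsf T(\mathbf u^1)$ is single-valued; consequently the KKT conditions \begin{align*} &x_{k+1}=A_kx_k+B_k^1u_k^1+B_k^2u_k^{2\star},\quad x_0=\bar x_0,\\ &p_k=Q_k^2x_k+A_k^\top p_{k+1}-{M_k^2}^\top\mu_k,\quad p_K=Q_K^2x_K,\\ &0=R_k^{22}u_k^{2\star}+{B_k^2}^\top p_{k+1}-{N_k^{22}}^\top\mu_k,\\ &0\le\mu_k\perp M_k^2x_k+N_k^{21}u_k^1+N_k^{22}u_k^{2\star}+r_k^2\ge0,\qquad k\in\mathsf K_l, \end{align*} are necessary and sufficient for optimality in the follower's problem $\min_{\mathbf u^2\in\Omega_2(\mathbf u^1)}J_2(\mathbf u^1,\mathbf u^2)$ (that is, $\mathbf u^{2\star}$ is optimal if and only if there exist $\mathbf x,\mathbf p,\boldsymbol\mu$ satisfying these conditions together with $\mathbf u^1,\mathbf u^{2\star}$). Further, $\{\mathbf x,\mathbf u^1,\mathbf u^{2\star},\mathbf p,\boldsymbol\mu\}=\{x_k,p_k,\ k\in\mathsf K;\ u_k^1,u_k^{2\star},\mu_k,\ k\in\mathsf K_l\}$ satisfies the KKT conditions \begin{align*} &x_{k+1}=A_kx_k+B_k^1u_k^1+B_k^2u_k^{2\star},\quad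 x_0=\bar x_0,\\ &p_k=Q_k^2x_k+A_k^\top p_{k+1}-{M_k^2}^\top\mu_k,\quad p_K=Q_K^2x_K,\\ &0=R_k^{22}u_k^{2\star}+{B_k^2}^\top p_{k+1}-{N_k^{22}}^\top\mu_k,\\ &0\le\mu_k\perp M_k^2x_k+N_k^{21}u_k^1+N_k^{22}u_k^{2\star}+r_k^2\ge0,\qquad k\in\mathsf K_l, \end{align*} if and only if, with $\zeta_k=p_k-P_kx_k$ for $k\in\mathsf K$, $$\mathsf T_k(\mathbf u^1)=u_k^{2\star}=L_k^xx_k+L_k^uu_k^1+L_k^\zeta\zeta_{k+1}+L_k^\mu\mu_k,\qquad k\in\mathsf K_l,$$ and $\{\mathbf x,\mathbf u^1,\boldsymbol\zeta,\boldsymbol\mu\}=\{x_k,\zeta_k,\ k\in\mathsf K;\ u_k^1,\mu_k,\ k\in\mathsf K_l\}$ satisfies, for all $k\in\mathsf K_l$, \begin{align*} &x_{k+1}=\overline A_kx_k+\overline B_ku_k^1+\overline C_k\mu_k+\overline D_k\zeta_{k+1},\quad x_0=\bar x_0,\\ &\zeta_k=\overline A_k^\top\zeta_{k+1}+\overline F_ku_k^1+\overline G_k\mu_k,\quad \zeta_K=0,\\ &0\le\mu_k\perp E_k^2x_k+S_k^2u_k^1+W_k^2\zeta_{k+1}+U_k^2\mu_k+r_k^2\ge0. \end{align*}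
   Context: Notation. $\mathbb S^n$ is the set of real symmetric $n\times n$ matrices; $\|x\|_A^2:=x^\top Ax$ for $A\in\mathbb S^n$ (not necessarily positive semidefinite). Vector inequalities are componentwise. $0\le x\perp y\ge0$ means $x\ge0$, $y\ge0$, $x^\top y=0$. Game. Player $1$ is the leader, player $2$ the follower. $K\ge1$ is an integer, $\mathsf K=\{0,1,\dots,K\}$, $\mathsf K_l=\{0,\dots,K-1\}$. The dynamics are $$x_{k+1}=A_kx_k+B_k^1u_k^1+B_k^2u_k^2,\quad k\in\mathsf K_l,\qquad x_0=\bar x_0,$$ with $A_k\in\mathbb R^{n\times n}$, $B_k^i\in\mathbb R^{n\times m_i}$, $u_k^i\in\mathbb R^{m_i}$, and given $\bar x_0\in\mathbb R^n$. An open-loop strategy of player $i$ is $\mathbf u^i=(u_k^i)_{k\in\mathsf K_l}\in\mathbb R^{Km_i}$; $x_k(\mathbf u^1,\mathbf u^2)$ is the resulting state at time $k$. The follower's constraints are, for $k\in\mathsf K_l$, $$g_k^2(x_k,u_k^1,u_k^2):=M_k^2x_k+N_k^{21}u_k^1+N_k^{22}u_k^2+r_k^2\ge0,$$ with $M_k^2\in\mathbb R^{c_2\times n}$, $N_k^{2j}\in\mathbb R^{c_2\times m_j}$, $r_k^2\in\mathbb R^{c_2}$. The follower's cost is $$J_2(\mathbf u^1,\mathbf u^2)=\tfrac12\|x_K\|_{Q_K^2}^2+\tfrac12\sum_{k\in\mathsf K_l}\big(\|x_k\|_{Q_k^2}^2+\|u_k^1\|_{R_k^{21}}^2+\|u_k^2\|_{R_k^{22}}^2\big),$$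 evaluated along the resulting state trajectory, with $Q_k^2\in\mathbb S^n$ ($k\in\mathsf K$), $R_k^{2j}\in\mathbb S^{m_j}$ ($k\in\mathsf K_l$). Feasible and reaction sets. $\Omega_2(\mathbf u^1):=\{\mathbf u^2\in\mathbb R^{Km_2}: g_k^2(x_k(\mathbf u^1,\mathbf u^2),u_k^1,u_k^2)\ge0\ \forall k\in\mathsf K_l\}$; $\mathsf U_1:=\{\mathbf u^1\in\mathbb R^{Km_1}:\Omega_2(\mathbf u^1)\ne\varnothing\}$; for $\mathbf u^1\in\mathsf U_1$, $\mathsf T(\mathbf u^1):=\arg\min_{\mathbf u^2\in\Omega_2(\mathbf u^1)}J_2(\mathbf u^1,\mathbf u^2)$ (when single-valued, i.e. a singleton, identified with its unique element, whose stage-$k$ component is $\mathsf T_k(\mathbf u^1)$). Here $p_k\in\mathbb R^n$ ($k\in\mathsf K$) are costates and $\mu_k\in\mathbb R^{c_2}$ ($k\in\mathsf K_l$) are multipliers. Assumption 1. (1) $\mathsf U_1\neq\varnothing$; (2) for each $\mathbf u^1\in\mathsf U_1$, $\Omega_2(\mathbf u^1)$ is bounded. Assumption 2. The solution of the Riccati difference equation $$P_k=Q_k^2+A_k^\top P_{k+1}A_k-V_k^\top\Gamma_k^{-1}V_k,\quad P_K=Q_K^2,\qquad \Gamma_k:=R_k^{22}+{B_k^2}^\top P_{k+1}B_k^2,\quad V_k:={B_k^2}^\top P_{k+1}A_k,$$ $k\in\mathsf K_l$, exists, and $\Gamma_k$ is positive definite for every $k\in\mathsf K_l$. Derived matrices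 ($k\in\mathsf K_l$). $L_k^x:=-\Gamma_k^{-1}V_k$, $L_k^u:=-\Gamma_k^{-1}{B_k^2}^\top P_{k+1}B_k^1$, $L_k^\zeta:=-\Gamma_k^{-1}{B_k^2}^\top$, $L_k^\mu:=\Gamma_k^{-1}{N_k^{22}}^\top$; $\overline A_k:=A_k+B_k^2L_k^x$, $\overline B_k:=B_k^1+B_k^2L_k^u$, $\overline C_k:=B_k^2L_k^\mu$, $\overline D_k:=B_k^2L_k^\zeta$, $\overline F_k:=A_k^\top P_{k+1}B_k^1+V_k^\top L_k^u$, $\overline G_k:=V_k^\top L_k^\mu-{M_k^2}^\top$; $E_k^2:=M_k^2+N_k^{22}L_k^x$, $S_k^2:=N_k^{21}+N_k^{22}L_k^u$, $W_k^2:=N_k^{22}L_k^\zeta$, $U_k^2:=N_k^{22}L_k^\mu$. *)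

(* Defs.v *)
From HB Require Import structures.
From mathcomp Require Import all_boot all_order all_algebra.
From mathcomp Require Import all_classical all_reals all_analysis.

Set Implicit Arguments.
Unset Strict Implicit.
Unset Printing Implicit Defensive.

Import Order.TTheory GRing.Theory Num.Theory.
Import numFieldNormedType.Exports.

Local Open Scope classical_set_scope.
Local Open Scope ring_scope.

Section LinearAlgebra.
Variable R : realType.

(* A need not be positive semidefinite. *)
Definition sqnorm (n : nat) (A : 'M[R]_n) (x : 'cV[R]_n) : R :=
  (x^T *m A *m x) 0 0.

(* Only applied to matrices that are symmetric by construction, so symmetry is
   not part of the definition. *)
Definition posdef (n : nat) (A : 'M[R]_n) : Prop :=
  forall x : 'cV[R]_n, x != 0 -> 0 < sqnorm A x.

Definition vec_ge0 (n : nat) (x : 'cV[R]_n) : Prop := forall i, 0 <= x i 0.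

Definition complementary (n : nat) (x y : 'cV[R]_n) : Prop :=
  [/\ vec_ge0 x, vec_ge0 y & x^T *m y = 0].

(* The library has convex_function but no strict version. *)
Definition strictly_convex (E : lmodType R) (f : E -> R) : Prop :=
  forall (x y : E) (t : R), x != y -> 0 < t -> t < 1 ->
    f (t *: x + (1 - t) *: y) < t * f x + (1 - t) * f y.

Definition argmin (E : Type) (f : E -> R) (D : set E) : set E :=
  [set x | D x /\ forall y, D y -> f x <= f y].

End LinearAlgebra.

(* Stages carrying a decision are 'I_K and stages carrying a state are
   'I_K.+1; a decision stage k is followed by the state stage k + 1. *)
Definition cur (K : nat) (k : 'I_K) : 'I_K.+1 := widen_ord (leqnSn K) k.
Definition next (K : nat) (k : 'I_K) : 'I_K.+1 := lift ord0 k.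

(* R^{K m}: the k-th column is the stage-k decision. *)
Definition strategy (R : realType) (K m : nat) := 'M[R]_(m, K).

(* The data on which the follower's problem depends. *)
Record game (R : realType) (K n m1 m2 c2 : nat) := Game {
  Adyn : 'I_K -> 'M[R]_n;
  B1 : 'I_K -> 'M[R]_(n, m1);
  B2 : 'I_K -> 'M[R]_(n, m2);
  xbar0 : 'cV[R]_n;
  M2 : 'I_K -> 'M[R]_(c2, n);
  N21 : 'I_K -> 'M[R]_(c2, m1);
  N22 : 'I_K -> 'M[R]_(c2, m2);
  r2 : 'I_K -> 'cV[R]_c2;
  Q2 : 'I_K.+1 -> 'M[R]_n;
  R21 : 'I_K -> 'M[R]_m1;
  R22 : 'I_K -> 'M[R]_m2;
  Q2_sym : forall k, (Q2 k)^T = Q2 k;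
  R21_sym : forall k, (R21 k)^T = R21 k;
  R22_sym : forall k, (R22 k)^T = R22 k
}.

Section Follower.
Variables (R : realType) (K n m1 m2 c2 : nat).
Variable G : game R K n m1 m2 c2.

Fixpoint state_rec (u1 : strategy R K m1) (u2 : strategy R K m2) (k : nat) :
    (k <= K)%N -> 'cV[R]_n :=
  match k with
  | 0 => fun _ => xbar0 G
  | k'.+1 => fun kK : (k' < K)%N =>
      let i := Ordinal kK in
      Adyn G i *m state_rec u1 u2 (ltnW kK)
        + B1 G i *m col i u1 + B2 G i *m col i u2
  end.

Definition state (u1 : strategy R K m1) (u2 : strategy R K m2)
  (k : 'I_K.+1) : 'cV[R]_n := state_rec u1 u2 (ltn_ord k).

Definition g2 (k : 'I_K) (x : 'cV[R]_n) (v1 : 'cV[R]_m1) (v2 : 'cV[R]_m2) :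
  'cV[R]_c2 := M2 G k *m x + N21 G k *m v1 + N22 G k *m v2 + r2 G k.

Definition J2 (u1 : strategy R K m1) (u2 : strategy R K m2) : R :=
  2^-1 * sqnorm (Q2 G ord_max) (state u1 u2 ord_max)
  + 2^-1 * \sum_(k < K) (sqnorm (Q2 G (cur k)) (state u1 u2 (cur k))
                         + sqnorm (R21 G k) (col k u1)
                         + sqnorm (R22 G k) (col k u2)).

Definition Omega2 (u1 : strategy R K m1) : set (strategy R K m2) :=
  [set u2 | forall k : 'I_K,
    vec_ge0 (g2 k (state u1 u2 (cur k)) (col k u1) (col k u2))].

Definition U1 : set (strategy R K m1) := [set u1 | Omega2 u1 !=set0].

Definition reaction (u1 : strategy R K m1) : set (strategy R K m2) :=
  argmin (J2 u1) (Omega2 u1).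

Definition regularity : Prop :=
  U1 !=set0 /\
  forall u1, U1 u1 -> bounded_set (Omega2 u1 : set 'M[R]_(m2, K)).

Definition dynamics (x : 'I_K.+1 -> 'cV[R]_n) (u1 : strategy R K m1)
    (u2 : strategy R K m2) : Prop :=
  x ord0 = xbar0 G /\
  forall k : 'I_K,
    x (next k) = Adyn G k *m x (cur k) + B1 G k *m col k u1
                 + B2 G k *m col k u2.

Definition KKT (x : 'I_K.+1 -> 'cV[R]_n) (u1 : strategy R K m1)
    (u2 : strategy R K m2) (p : 'I_K.+1 -> 'cV[R]_n)
    (mu : 'I_K -> 'cV[R]_c2) : Prop :=
  [/\ dynamics x u1 u2,
      p ord_max = Q2 G ord_max *m x ord_max /\
      (forall k : 'I_K,
        p (cur k) = Q2 G (cur k) *m x (cur k) + (Adyn G k)^T *m p (next k)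
                    - (M2 G k)^T *m mu k),
      forall k : 'I_K,
        0 = R22 G k *m col k u2 + (B2 G k)^T *m p (next k)
            - (N22 G k)^T *m mu k
    & forall k : 'I_K,
        complementary (mu k)
          (M2 G k *m x (cur k) + N21 G k *m col k u1 + N22 G k *m col k u2
           + r2 G k)].

Section Riccati.
Variable P : 'I_K.+1 -> 'M[R]_n.

Definition Gamma (k : 'I_K) : 'M[R]_m2 :=
  R22 G k + (B2 G k)^T *m P (next k) *m B2 G k.
Definition V (k : 'I_K) : 'M[R]_(m2, n) :=
  (B2 G k)^T *m P (next k) *m Adyn G k.

(* invmx is a true inverse here, since a positive definite matrix is
   invertible. *)
Definition riccati : Prop :=
  [/\ P ord_max = Q2 G ord_max,
      forall k : 'I_K,
        P (cur k) = Q2 G (cur k) + (Adyn G k)^T *m P (next k) *m Adyn G k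
                    - (V k)^T *m invmx (Gamma k) *m V k
    & forall k : 'I_K, posdef (Gamma k)].

Definition Lx (k : 'I_K) := - (invmx (Gamma k) *m V k).
Definition Lu (k : 'I_K) :=
  - (invmx (Gamma k) *m (B2 G k)^T *m P (next k) *m B1 G k).
Definition Lzeta (k : 'I_K) := - (invmx (Gamma k) *m (B2 G k)^T).
Definition Lmu (k : 'I_K) := invmx (Gamma k) *m (N22 G k)^T.

Definition Abar (k : 'I_K) := Adyn G k + B2 G k *m Lx k.
Definition Bbar (k : 'I_K) := B1 G k + B2 G k *m Lu k.
Definition Cbar (k : 'I_K) := B2 G k *m Lmu k.
Definition Dbar (k : 'I_K) := B2 G k *m Lzeta k.
Definition Fbar (k : 'I_K) :=
  (Adyn G k)^T *m P (next k) *m B1 G k + (V k)^T *m Lu k.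
Definition Gbar (k : 'I_K) := (V k)^T *m Lmu k - (M2 G k)^T.

Definition E2 (k : 'I_K) := M2 G k + N22 G k *m Lx k.
Definition S2 (k : 'I_K) := N21 G k + N22 G k *m Lu k.
Definition W2 (k : 'I_K) := N22 G k *m Lzeta k.
Definition U2 (k : 'I_K) := N22 G k *m Lmu k.

Definition response_formula (x : 'I_K.+1 -> 'cV[R]_n) (u1 : strategy R K m1)
    (u2 : strategy R K m2) (zeta : 'I_K.+1 -> 'cV[R]_n)
    (mu : 'I_K -> 'cV[R]_c2) : Prop :=
  forall k : 'I_K,
    col k u2 = Lx k *m x (cur k) + Lu k *m col k u1
               + Lzeta k *m zeta (next k) + Lmu k *m mu k.

Definition reduced_system (x : 'I_K.+1 -> 'cV[R]_n) (u1 : strategy R K m1)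
    (zeta : 'I_K.+1 -> 'cV[R]_n) (mu : 'I_K -> 'cV[R]_c2) : Prop :=
  [/\ x ord0 = xbar0 G /\
      (forall k : 'I_K,
        x (next k) = Abar k *m x (cur k) + Bbar k *m col k u1
                     + Cbar k *m mu k + Dbar k *m zeta (next k)),
      zeta ord_max = 0 /\
      (forall k : 'I_K,
        zeta (cur k) = (Abar k)^T *m zeta (next k) + Fbar k *m col k u1
                       + Gbar k *m mu k)
    & forall k : 'I_K,
        complementary (mu k)
          (E2 k *m x (cur k) + S2 k *m col k u1 + W2 k *m zeta (next k)
           + U2 k *m mu k + r2 G k)].

End Riccati.
End Follower.

(* Main.v *)
Require Import Defs.
From HB Require Import structures.
From mathcomp Require Import all_boot all_order all_algebra.
From mathcomp Require Import all_classical all_reals all_analysis.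
From mathcomp Require Import ring lra.

(** As a function of the follower's strategy the cost is quadratic, and its
    Hessian [hess] is twice the cost of the homogeneous system started at 0 with
    the leader inactive.  The Riccati equation completes the square at each
    stage ([riccati_completion]), and the sum telescopes to a sum of
    [Gamma]-squared norms of deviations from a linear feedback
    ([hess_squares]).  Such a sum vanishes only for the zero strategy, so [hess]
    is an inner product ([hess_gt0]) and the cost is strictly convex.

    In this inner product minimizing the cost amounts to projecting its
    unconstrained minimizer onto the polyhedron of feasible strategies; the
    gradients become vectors by [riesz_representation].
    [polyhedral_projection] constructs, by induction on the constraints, a point
    of a nonempty polyhedron together with nonnegative complementary
    multipliers; the construction is purely algebraic.  So a feasible stationary
    point with multipliers exists ([stationary_exists]).  A direct second-order
    expansion shows that any such point is the unique minimizer
    ([stationary_optimal]).  These two facts give at once that the reaction is a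
    singleton and that the KKT conditions are necessary and sufficient.  The
    costate enters only as a way of writing stationarity stage by stage,
    through summation by parts ([adjoint_identity], [stationaryP]).

    For the last equivalence, put [p = P x + zeta].  The stationarity equation
    at stage [k] then reads [Gamma k] times (control minus response) [= 0], and
    the Riccati equation removes the terms in [x] from the costate recursion, so
    that the KKT system and the reduced system agree stage by stage
    ([KKT_reduced]). *)

Set Implicit Arguments.
Unset Strict Implicit.
Unset Printing Implicit Defensive.

Import Order.TTheory GRing.Theory Num.Theory.
Import numFieldNormedType.Exports.

Local Open Scope ring_scope.

(** * Projection onto a polyhedron in an inner product space *)

Section PolyhedralProjection.
(* Sets of indices are finite sets here, not classical ones. *)
Import mathcomp.boot.finset.
Variables (R : realFieldType) (E : lmodType R) (ip : E -> E -> R).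
Hypothesis ipC : forall u v, ip u v = ip v u.
Hypothesis ip_linear : forall a u v w,
  ip (a *: u + v) w = a * ip u w + ip v w.
Hypothesis ip_gt0 : forall u, u != 0 -> 0 < ip u u.

Lemma ip0l w : ip 0 w = 0.
Proof. by have := ip_linear 1 0 0 w; rewrite scaler0 addr0 => h; lra. Qed.

Lemma ipDl u v w : ip (u + v) w = ip u w + ip v w.
Proof. by rewrite -[u]scale1r ip_linear scale1r mul1r. Qed.

Lemma ipZl a u w : ip (a *: u) w = a * ip u w.
Proof. by rewrite -[a *: u]addr0 ip_linear ip0l addr0. Qed.

Lemma ipBl u v w : ip (u - v) w = ip u w - ip v w.
Proof. by rewrite ipDl -scaleN1r ipZl mulN1r. Qed.

Lemma ipDr u v w : ip w (u + v) = ip w u + ip w v.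
Proof. by rewrite ipC ipDl !(ipC w). Qed.

Lemma ipZr a u w : ip w (a *: u) = a * ip w u.
Proof. by rewrite ipC ipZl (ipC w). Qed.

Lemma ipBr u v w : ip w (u - v) = ip w u - ip w v.
Proof. by rewrite ipC ipBl !(ipC w). Qed.

Lemma ip_ge0 u : 0 <= ip u u.
Proof.
by case: (eqVneq u 0) => [->|/ip_gt0 /ltW//]; rewrite ip0l.
Qed.

Variables (I : finType) (a : I -> E).

Lemma ip_suml (lam : I -> R) w :
  ip (\sum_i lam i *: a i) w = \sum_i lam i * ip (a i) w.
Proof.
elim/big_ind2: _ => [|u x v y <- <-|i _]; rewrite ?ip0l ?ipDl ?ipZl //.
Qed.

Definition slack (b : I -> R) (i : I) (z : E) : R := ip (a i) z + b i.

Lemma slack_segment b i z w s :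
  slack b i (z + s *: (w - z)) = (1 - s) * slack b i z + s * slack b i w.
Proof. by rewrite /slack ipDr ipZr ipBr; ring. Qed.

(** If [z] is obtained from [c] by moving along the normals with weights
    [lam], the inner product that a variational inequality asks about is a
    weighted sum of slack differences, so signs and complementarity decide
    it. *)
Lemma ip_multipliers b lam c z w : z = c + \sum_i lam i *: a i ->
  ip (z - c) (w - z) = \sum_i lam i * (slack b i w - slack b i z).
Proof.
move=> ->; rewrite [c + _]addrC addrK ip_suml; apply: eq_bigr => i _.
by rewrite ipBr /slack; congr (_ * _); ring.
Qed.

(** The induction adds one equation at a time: correct the projection [z] for
    the previous equations along [d], the component of the new normal orthogonal
    to the previous ones, which leaves those equations intact.  The vector [d]
    is itself a projection, of [a i], and so a combination of normals. *)
Lemma affine_projection (A : {set I}) b c :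
    (exists w, forall i, i \in A -> slack b i w = 0) ->
  exists lam : I -> R, (forall i, i \notin A -> lam i = 0) /\
    forall i, i \in A -> slack b i (c + \sum_j lam j *: a j) = 0.
Proof.
have [n] := ubnP #|A|; elim: n => [|n IH] //= in A b c *.
move=> cardA [w wA].
have [->|[i iA]] := set_0Vmem A.
  by exists (fun=> 0); split=> // i; rewrite inE.
have cardAi : (#|A :\ i| < n)%N.
  by move: cardA; rewrite (cardsD1 i) iA add1n ltnS.
have [|lam [lam0 lamA]] := IH (A :\ i) b c cardAi.
  by exists w => j /setD1P[_]; exact: wA.
have [|nu [nu0 nuA]] := IH (A :\ i) (fun=> 0) (a i) cardAi.
  by exists 0 => j _; rewrite /slack addr0 ipC ip0l.
set z := c + _ in lamA; set d := a i + _ in nuA.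
have dA j : j != i -> j \in A -> ip (a j) d = 0.
  by move=> ji jA; have := nuA j; rewrite !inE ji jA /slack addr0; exact.
have dd : ip (a i) d = ip d d.
  rewrite {2}/d ipDl ip_suml big1 ?addr0 // => j _.
  case: (boolP (j \in A :\ i)) => [/setD1P[ji jA]|/nu0->];
    last by rewrite mul0r.
  by rewrite dA ?mulr0.
(* The step that brings the new equation to zero; it is 0 when d = 0. *)
pose t := - slack b i z / ip d d.
have ti : slack b i z + t * ip d d = 0.
  have [d0|dn0] := eqVneq d 0; last first.
    by rewrite /t divfK ?subrr //; apply: lt0r_neq0; exact: ip_gt0.
  (* a i is then a combination of the other normals, so its equation, which
     holds at w, holds wherever the other equations do. *)
  rewrite d0 ip0l mulr0 addr0 -(wA i iA) /slack.
  have := f_equal (ip^~ (z - w)) d0; rewrite ip0l /d ipDl ip_suml big1.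
    by rewrite addr0 ipBr => h; lra.
  move=> j _; case: (boolP (j \in A :\ i)) => [jA|/nu0->];
    last by rewrite mul0r.
  have := lamA j jA; have := wA j; case/setD1P: jA => _ jA /(_ jA).
  rewrite /slack ipBr => h1 h2.
  suff -> : ip (a j) z - ip (a j) w = 0 by rewrite mulr0.
  by lra.
(* The weights of z + t d: those of z, plus t times those of d = a i + ... *)
exists (fun j => lam j + t * (nu j + (j == i)%:R)); split=> [j jA|j jA].
  have ji : j != i by apply: contraNneq jA => ->.
  by rewrite (negPf ji) lam0 ?nu0 ?inE ?negb_and ?jA ?orbT // addr0 mulr0 addr0.
have -> : c + \sum_k (lam k + t * (nu k + (k == i)%:R)) *: a k = z + t *: d.
  rewrite /z /d -addrA; congr (_ + _).
  under eq_bigr do rewrite scalerDl -scalerA scalerDl.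
  rewrite big_split /= -scaler_sumr big_split /=; congr (_ + _ *: _).
  rewrite addrC; congr (_ + _).
  rewrite (bigD1 i) //= eqxx scale1r big1 ?addr0 // => k /negPf->.
  by rewrite scale0r.
rewrite /slack ipDr ipZr; have [->|ji] := eqVneq j i.
  by rewrite dd -ti /slack; ring.
by rewrite dA // mulr0 addr0; apply: lamA; rewrite !inE ji.
Qed.

(** Active-set induction on the inequalities [J]: let [z] solve the problem
    without inequality [i].  If [z] satisfies it, [i] gets multiplier 0.
    Otherwise [i] is made an equation; the point [z'] obtained satisfies the
    conditions except perhaps for the sign of its multiplier at [i].  That sign
    is right because [z] is closer to [c] than [z'] and lies on the wrong side
    of [i].  Equations appear in the statement only for this induction. *)
Lemma mixed_projection (A J : {set I}) b c : [disjoint A & J] ->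
    (exists w, (forall i, i \in A -> slack b i w = 0) /\
               (forall i, i \in J -> 0 <= slack b i w)) ->
  exists lam : I -> R, let z := c + \sum_i lam i *: a i in
    [/\ forall i, i \notin A :|: J -> lam i = 0,
        forall i, i \in A -> slack b i z = 0
      & forall i, i \in J ->
          [/\ 0 <= lam i, 0 <= slack b i z & lam i * slack b i z = 0]].
Proof.
have [n] := ubnP #|J|; elim: n => [|n IH] //= in A J *.
move=> cardJ AJ [w [wA wJ]].
have [J0|[i iJ]] := set_0Vmem J.
  have [|lam [lam0 lamA]] := @affine_projection A b c; first by exists w.
  by exists lam; split=> // i; rewrite J0 ?setU0 ?inE //; exact: lam0.
have iA : i \notin A by rewrite (disjointFl AJ).
have cardJi : (#|J :\ i| < n)%N.
  by move: cardJ; rewrite (cardsD1 i) iJ add1n ltnS.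
have AJi : [disjoint A & J :\ i].
  by apply: disjointWr AJ; exact: subD1set.
have [|lam /= [lam0 lamA lamJ]] := IH A (J :\ i) cardJi AJi.
  by exists w; split=> // j /setD1P[_]; exact: wJ.
set z := c + _ in lamA lamJ.
have [zi|zi] := leP 0 (slack b i z).
  exists lam; split=> // [j|j jJ].
    rewrite !inE negb_or => /andP[jA jJ].
    by rewrite lam0 // !inE (negPf jA) (negPf jJ) andbF.
  have [->|ji] := eqVneq j i; last by apply: lamJ; rewrite !inE ji.
  by rewrite lam0 ?mul0r ?inE ?eqxx ?(negPf iA).
have AiJi : [disjoint i |: A & J :\ i].
  by rewrite disjoints_subset subUset sub1set -disjoints_subset AJi !inE eqxx.
(* The segment from z to the feasible point w meets the hyperplane of i, which
   makes the problem with equation i feasible. *)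
have [|lam' /= [lam'0 lam'A lam'J]] := IH (i |: A) (J :\ i) cardJi AiJi.
  have wi : 0 <= slack b i w by exact: wJ.
  pose s := - slack b i z / (slack b i w - slack b i z).
  have den : 0 < slack b i w - slack b i z by lra.
  have s0 : 0 <= s by rewrite divr_ge0 //; lra.
  have s1 : s <= 1 by rewrite ler_pdivrMr // mul1r; lra.
  exists (z + s *: (w - z)); split=> j; rewrite slack_segment.
    case/setU1P=> [->|jA]; last by rewrite lamA // wA // !mulr0 addr0.
    have : s * (slack b i w - slack b i z) = - slack b i z.
      by rewrite divfK // gt_eqF.
    by move=> h; lra.
  move=> jJ; have [_ zj _] := lamJ j jJ; case/setD1P: jJ => _ /wJ wj.
  by rewrite addr_ge0 // mulr_ge0 // subr_ge0.
set z' := c + _ in lam'A lam'J.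
(* Adding the variational inequalities at z and at z' bounds
   lam' i * slack b i z by - ip (z' - z) (z' - z). *)
have lam'i : 0 <= lam' i.
  have h1 : 0 <= ip (z - c) (z' - z).
    rewrite (@ip_multipliers b lam c z z') //; apply: sumr_ge0 => j _.
    case: (boolP (j \in J :\ i)) => jJ.
      have [lamj _ ej] := lamJ j jJ; have [_ z'j _] := lam'J j jJ.
      by rewrite mulrBr ej subr0 mulr_ge0.
    case: (boolP (j \in A)) => jA.
      by rewrite lamA // lam'A ?subrr ?mulr0 // !inE jA orbT.
    by rewrite lam0 ?mul0r // in_setU negb_or jA jJ.
  have h2 : lam' i * slack b i z <= ip (z' - c) (z - z').
    rewrite (@ip_multipliers b lam' c z' z) // (bigD1 i) //=.
    rewrite lam'A ?setU11 // subr0 lerDl; apply: sumr_ge0 => j ji.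
    case: (boolP (j \in J :\ i)) => jJ.
      have [lamj _ ej] := lam'J j jJ; have [_ zj _] := lamJ j jJ.
      by rewrite mulrBr ej subr0 mulr_ge0.
    case: (boolP (j \in A)) => jA.
      by rewrite lamA // lam'A ?subrr ?mulr0 // !inE jA orbT.
    by rewrite lam'0 ?mul0r // in_setU in_setU1 !negb_or ji jA jJ.
  have := ip_ge0 (z' - z); move: h1 h2; rewrite !(ipBl, ipBr).
  rewrite (ipC z' z) (ipC c z) (ipC c z') => h1 h2 h3.
  by rewrite -(ler_nM2r zi) mul0r; lra.
exists lam'; split=> [j|j jA|j jJ].
- rewrite !inE negb_or => /andP[jA jJ]; have ji : j != i.
    by apply: contraNneq jJ => ->.
  by apply: lam'0; rewrite !inE (negPf ji) (negPf jA) (negPf jJ).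
- by apply: lam'A; rewrite !inE jA orbT.
- have [->|ji] := eqVneq j i; last by apply: lam'J; rewrite !inE ji.
  by rewrite lam'A ?setU11 ?mulr0.
Qed.

(** The nearest point to [c] in a nonempty polyhedron, with its multipliers:
    existence of a minimizer and necessity of the KKT conditions are obtained
    together. *)
Lemma polyhedral_projection b c : (exists w, forall i, 0 <= slack b i w) ->
  exists lam : I -> R, let z := c + \sum_i lam i *: a i in
    forall i, [/\ 0 <= lam i, 0 <= slack b i z & lam i * slack b i z = 0].
Proof.
move=> [w wI]; have [||lam [_ _ lamI]] := @mixed_projection set0 setT b c.
- by rewrite disjoints_subset sub0set.
- by exists w; split=> i; rewrite ?inE.
- by exists lam => z i; apply: lamI; rewrite inE.
Qed.
End PolyhedralProjection.

(** * Riesz representation in finite dimension *)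

Section Riesz.
Variables (R : realFieldType) (E : vectType R) (ip : E -> E -> R).
Hypothesis ipC : forall u v, ip u v = ip v u.
Hypothesis ip_linear : forall a u v w,
  ip (a *: u + v) w = a * ip u w + ip v w.
Hypothesis ip_gt0 : forall u, u != 0 -> 0 < ip u u.

(** The map sending [z] to the coordinates of [ip z] on a basis is injective by
    definiteness, hence surjective by dimension. *)
Lemma riesz_representation (phi : E -> R) :
    (forall a u v, phi (a *: u + v) = a * phi u + phi v) ->
  exists z, forall v, ip z v = phi v.
Proof.
move=> phi_linear; pose X := vbasis {:E}.
have eqX (f : E -> R) :
    (forall a u v, f (a *: u + v) = a * f u + f v) ->
    (forall i : 'I_(\dim {:E}), f X`_i = 0) -> forall v, f v = 0.
  move=> f_linear fX v.
  have f0 : f 0 = 0 by have := f_linear 1 0 0; rewrite scaler0 addr0 => h; lra.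
  rewrite (coord_vbasis (memvf v)); elim/big_ind: _ => // [u w fu fw|i _].
    by rewrite -[u]scale1r f_linear fu fw mulr0 addr0.
  by rewrite -[_ *: _]addr0 f_linear fX f0 mulr0 addr0.
pose F (z : E) : 'rV[R]_(\dim {:E}) := \row_i ip z X`_i.
have F_linear : linear F.
  by move=> t u v; apply/rowP=> i; rewrite !mxE ip_linear.
pose FL := GRing.isLinear.Build R E 'rV[R]_(\dim {:E}) _ F F_linear.
pose f : {linear E -> 'rV[R]_(\dim {:E})} := HB.pack F FL.
have kerf : lker (linfun f) == 0%VS.
  rewrite -subv0; apply/subvP=> z; rewrite memv_ker memv0 lfunE /= => /eqP Fz.
  apply/negPn/negP=> /ip_gt0; rewrite (eqX (ip z)) ?ltxx // => [t u v|i].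
    by rewrite ipC ip_linear !(ipC z).
  by have /rowP/(_ i) := Fz; rewrite !mxE.
have imf : limg (linfun f) = fullv.
  apply/eqP; rewrite eqEdim subvf /= limg_dim_eq.
    by rewrite dimvf /dim /= mul1n.
  by rewrite (eqP kerf) capv0.
have /memv_imgP[z _ zE] :
    (\row_i phi X`_i : 'rV_(\dim {:E})) \in limg (linfun f).
  by rewrite imf memvf.
exists z => v; apply/eqP; rewrite -subr_eq0; apply/eqP.
apply: (eqX (fun v => ip z v - phi v)) => [t u w|i].
  by rewrite phi_linear ipC ip_linear !(ipC z); ring.
by move: zE; rewrite lfunE /= => /rowP/(_ i); rewrite !mxE => ->; rewrite subrr.
Qed.
End Riesz.

Local Open Scope classical_set_scope.
Local Open Scope ring_scope.

(* Here next is the following stage, not the successor in a cyclic sequence. *)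
Local Notation next := Defs.next.

(** * Inner products of column vectors *)

Section Dot.
Variable R : realType.

Definition dot (n : nat) (x y : 'cV[R]_n) : R := (x^T *m y) 0 0.

(** Expanding one sum of matrices at an entry reduces additive identities
    between matrix products to commutative ring identities; a general entry
    lemma would also expand the products. *)
Lemma entryD m n (A B : 'M[R]_(m, n)) i j : (A + B) i j = A i j + B i j.
Proof. by rewrite mxE. Qed.

Lemma entryN m n (A : 'M[R]_(m, n)) i j : (- A) i j = - A i j.
Proof. by rewrite mxE. Qed.

Lemma dotE n (x y : 'cV[R]_n) : dot x y = \sum_i x i 0 * y i 0.
Proof. by rewrite /dot mxE; apply: eq_bigr => i _; rewrite mxE. Qed.

Lemma dotC n (x y : 'cV[R]_n) : dot x y = dot y x.
Proof. by rewrite !dotE; apply: eq_bigr => i _; rewrite mulrC. Qed.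

Lemma dotDr n (x y z : 'cV[R]_n) : dot x (y + z) = dot x y + dot x z.
Proof. by rewrite /dot mulmxDr mxE. Qed.

Lemma dotZr n a (x y : 'cV[R]_n) : dot x (a *: y) = a * dot x y.
Proof. by rewrite /dot -scalemxAr mxE. Qed.

Lemma dotNr n (x y : 'cV[R]_n) : dot x (- y) = - dot x y.
Proof. by rewrite /dot mulmxN mxE. Qed.

Lemma dotDl n (x y z : 'cV[R]_n) : dot (x + y) z = dot x z + dot y z.
Proof. by rewrite dotC dotDr !(dotC z). Qed.

Lemma dotZl n a (x y : 'cV[R]_n) : dot (a *: x) y = a * dot x y.
Proof. by rewrite dotC dotZr dotC. Qed.

Lemma dot0r n (x : 'cV[R]_n) : dot x 0 = 0.
Proof. by rewrite /dot mulmx0 mxE. Qed.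

Lemma dot0l n (x : 'cV[R]_n) : dot 0 x = 0.
Proof. by rewrite dotC dot0r. Qed.

Lemma dot_trmx m n (A : 'M[R]_(m, n)) x y : dot (A^T *m x) y = dot x (A *m y).
Proof. by rewrite /dot trmx_mul trmxK mulmxA. Qed.

Lemma dot_sym n (A : 'M[R]_n) x y : A^T = A -> dot x (A *m y) = dot y (A *m x).
Proof. by move=> symA; rewrite -dot_trmx symA dotC. Qed.

Lemma sqnormE n (A : 'M[R]_n) x : sqnorm A x = dot x (A *m x).
Proof. by rewrite /sqnorm /dot mulmxA. Qed.

Lemma dot_eq0 n (x : 'cV[R]_n) : dot x x = 0 -> x = 0.
Proof.
rewrite dotE => /eqP; rewrite psumr_eq0 => [/allP x0|i _]; last first.
  by rewrite -expr2 sqr_ge0.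
apply/colP => i; have := x0 i (mem_index_enum i).
by rewrite mxE mulf_eq0 orbb => /eqP.
Qed.

Lemma posdef_unitmx n (A : 'M[R]_n) : posdef A -> A \in unitmx.
Proof.
move=> posA; rewrite -unitmx_tr -row_free_unit -kermx_eq0; apply/rowV0P => v.
move/sub_kermxP/(f_equal trmx); rewrite trmx_mul trmxK trmx0 => Av0.
apply: trmx_inj; rewrite trmx0; apply/eqP/negPn/negP => /posA.
by rewrite sqnormE Av0 dot0r ltxx.
Qed.

Lemma posdef_sqnorm_ge0 n (A : 'M[R]_n) x : posdef A -> 0 <= sqnorm A x.
Proof.
move=> posA; case: (eqVneq x 0) => [->|/posA/ltW//].
by rewrite sqnormE dot0l.
Qed.

Lemma complementary_dot n (x y : 'cV[R]_n) : complementary x y -> dot x y = 0.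
Proof. by move=> [_ _ xy]; rewrite /dot xy mxE. Qed.

Lemma complementaryP n (x y : 'cV[R]_n) :
  complementary x y <->
  forall i, [/\ 0 <= x i 0, 0 <= y i 0 & x i 0 * y i 0 = 0].
Proof.
split=> [xyc|xy].
  have [x0 y0 _] := xyc; have /eqP := complementary_dot xyc; rewrite dotE.
  rewrite psumr_eq0 => [/allP xy0 i|i _]; last by rewrite mulr_ge0.
  by split=> //; apply/eqP; exact: (xy0 i (mem_index_enum i)).
split=> [i|i|]; try by have [] := xy i.
apply/matrixP=> i j; rewrite !ord1 -/(dot x y) dotE mxE big1 // => l _.
by have [] := xy l.
Qed.

End Dot.

(** * Induction and telescoping over stages *)

Section Stages.
Variable K : nat.

Lemma stage_ind (Pr : 'I_K.+1 -> Prop) :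
  Pr ord0 -> (forall k : 'I_K, Pr (cur k) -> Pr (next k)) -> forall k, Pr k.
Proof.
move=> P0 PS [k kK]; elim: k kK => [|k IH] kK.
  by rewrite (_ : Ordinal kK = ord0) //; exact: val_inj.
rewrite (_ : Ordinal kK = next (Ordinal (kK : (k < K)%N))); last exact: val_inj.
apply: PS; rewrite (_ : cur _ = Ordinal (ltnW kK)); last exact: val_inj.
exact: IH.
Qed.

Lemma stage_ind_rev (Pr : 'I_K.+1 -> Prop) :
  Pr ord_max -> (forall k : 'I_K, Pr (next k) -> Pr (cur k)) ->
  forall k, Pr k.
Proof.
move=> PK PS k; have [j] : exists j, (K - k)%N = j by eexists.
elim: j k => [|j IH] k kj.
  rewrite (_ : k = ord_max) //; apply: val_inj => /=; apply/eqP.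
  by rewrite eqn_leq -ltnS ltn_ord /= -subn_eq0 kj.
have kK : (k < K)%N by rewrite -subn_gt0 kj.
rewrite (_ : k = cur (Ordinal kK)); last exact: val_inj.
by apply: PS; apply: IH; rewrite /= /bump /= add1n subnS kj.
Qed.

Lemma stage_telescope (R : zmodType) (F : 'I_K.+1 -> R) :
  \sum_(k < K) (F (next k) - F (cur k)) = F ord_max - F ord0.
Proof.
rewrite sumrB; apply: (addrI (F ord0)).
have recl := @big_ord_recl _ 0 +%R K F; rewrite big_ord_recr in recl.
by rewrite addrA -recl /= addrAC subrr add0r addrCA subrr addr0.
Qed.

End Stages.

(** Used for the costate, which is prescribed at the final stage. *)
Lemma backward_recursion (T : Type) (K : nat) (f : 'I_K -> T -> T) (last : T) :
  exists p : 'I_K.+1 -> T,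
    p ord_max = last /\ forall k, p (cur k) = f k (p (next k)).
Proof.
elim: K f => [|K IH] f; first by exists (fun=> last); split=> // -[].
have [p [pK pS]] := IH (fun k => f (lift ord0 k)).
exists (fun k => if unlift ord0 k is Some j then p j else f ord0 (p ord0)).
split=> [|k].
  by rewrite (_ : ord_max = lift ord0 ord_max) ?liftK //; exact: val_inj.
rewrite liftK; case: (unliftP ord0 k) => [j ->|->].
  rewrite (_ : cur (lift ord0 j) = lift ord0 (cur j)); last exact: val_inj.
  by rewrite liftK pS.
rewrite (_ : cur ord0 = ord0); last exact: val_inj.
by rewrite unlift_none.
Qed.

(** * State trajectories and their variations *)

Section Trajectories.
Variables (R : realType) (K n m1 m2 c2 : nat) (G : game R K n m1 m2 c2).
Implicit Types u v w : strategy R K m2.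

Lemma stateS (u1 : strategy R K m1) u (k : 'I_K) :
  state G u1 u (next k) =
    Adyn G k *m state G u1 u (cur k) + B1 G k *m col k u1 + B2 G k *m col k u.
Proof.
rewrite /state /=; set h := ltn_ord (next k); clearbody h.
rewrite (_ : Ordinal _ = k); last exact: val_inj.
congr (_ *m _ + _ + _); congr (state_rec _ _ _); exact: bool_irrelevance.
Qed.

Lemma dynamicsP x (u1 : strategy R K m1) u :
  dynamics G x u1 u <-> forall k, x k = state G u1 u k.
Proof.
split=> [[x0 xS]|xE]; last by split=> [|k]; rewrite !xE // stateS.
by apply: stage_ind => [|k IH]; rewrite ?x0 // xS stateS IH.
Qed.

End Trajectories.

Section Game.
Variables (R : realType) (K n m1 m2 c2 : nat) (G : game R K n m1 m2 c2).
Implicit Types u v w : strategy R K m2.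

(** Its trajectory driven by the follower alone is the linear part, in the
    follower's strategy, of every trajectory of [G]. *)
Definition homogeneous : game R K n m1 m2 c2 :=
  Game (Adyn G) (B1 G) (B2 G) 0 (M2 G) (N21 G) (N22 G) (r2 G)
    (Q2_sym G) (R21_sym G) (R22_sym G).

Definition variation v (k : 'I_K.+1) : 'cV[R]_n := state homogeneous 0 v k.

Lemma variation0 v : variation v ord0 = 0.
Proof. by []. Qed.

Lemma variationS v k : variation v (next k) =
  Adyn G k *m variation v (cur k) + B2 G k *m col k v.
Proof. by rewrite /variation stateS col0 mulmx0 addr0. Qed.

Lemma col_linear a u v (k : 'I_K) : col k (a *: u + v) = a *: col k u + col k v.
Proof. by apply/colP=> i; rewrite !mxE. Qed.

Lemma colD u v (k : 'I_K) : col k (u + v) = col k u + col k v.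
Proof. by rewrite -[u in LHS]scale1r col_linear scale1r. Qed.

Lemma variation_linear a u v k :
  variation (a *: u + v) k = a *: variation u k + variation v k.
Proof.
elim/stage_ind: k => [|k IH]; first by rewrite !variation0 scaler0 addr0.
rewrite !variationS IH col_linear !mulmxDr -!scalemxAr scalerDr.
by rewrite addrACA.
Qed.

Lemma stateD (u1 : strategy R K m1) u v k :
  state G u1 (u + v) k = state G u1 u k + variation v k.
Proof.
elim/stage_ind: k => [|k IH]; first by rewrite variation0 addr0.
rewrite !stateS variationS IH colD.
by rewrite !mulmxDr; apply/colP => i; rewrite !entryD; ring.
Qed.

(** * Second-order expansion of the follower's cost *)

(** The Hessian of the follower's cost, the same at every point because the
    cost is quadratic; also independent of the leader. *)
Definition hess u v : R :=
  dot (variation u ord_max) (Q2 G ord_max *m variation v ord_max)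
  + \sum_(k < K)
      (dot (variation u (cur k)) (Q2 G (cur k) *m variation v (cur k))
       + dot (col k u) (R22 G k *m col k v)).

(** The derivative of the follower's cost at [u] in the direction [v]. *)
Definition slope (u1 : strategy R K m1) u v : R :=
  dot (variation v ord_max) (Q2 G ord_max *m state G u1 u ord_max)
  + \sum_(k < K)
      (dot (variation v (cur k)) (Q2 G (cur k) *m state G u1 u (cur k))
       + dot (col k v) (R22 G k *m col k u)).

Lemma hessC u v : hess u v = hess v u.
Proof.
rewrite /hess dot_sym ?Q2_sym //; congr (_ + _); apply: eq_bigr => k _.
by rewrite dot_sym ?Q2_sym // [in X in _ + X]dot_sym ?R22_sym.
Qed.

Lemma hess_linear a u v w : hess (a *: u + v) w = a * hess u w + hess v w.
Proof.
rewrite /hess variation_linear dotDl dotZl mulrDr mulr_sumr addrACA.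
congr (_ + _); rewrite -big_split; apply: eq_bigr => k _ /=.
by rewrite variation_linear col_linear !dotDl !dotZl mulrDr addrACA.
Qed.

Lemma slope_linear (u1 : strategy R K m1) u a v w :
  slope u1 u (a *: v + w) = a * slope u1 u v + slope u1 u w.
Proof.
rewrite /slope variation_linear dotDl dotZl mulrDr mulr_sumr addrACA.
congr (_ + _); rewrite -big_split; apply: eq_bigr => k _ /=.
by rewrite variation_linear col_linear !dotDl !dotZl mulrDr addrACA.
Qed.

Lemma slopeD (u1 : strategy R K m1) u w v :
  slope u1 (u + w) v = slope u1 u v + hess w v.
Proof.
rewrite hessC /slope /hess stateD mulmxDr dotDr [RHS]addrACA.
congr (_ + _); rewrite -big_split; apply: eq_bigr => k _ /=.
by rewrite stateD colD !mulmxDr !dotDr addrACA.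
Qed.

Lemma sqnormD p (A : 'M[R]_p) x y : A^T = A ->
  sqnorm A (x + y) = sqnorm A x + 2 * dot y (A *m x) + dot y (A *m y).
Proof.
move=> symA; rewrite !sqnormE mulmxDr !dotDl !dotDr (dot_sym x y symA).
by ring.
Qed.

Lemma J2_taylor (u1 : strategy R K m1) u v :
  J2 G u1 (u + v) = J2 G u1 u + slope u1 u v + 2^-1 * hess v v.
Proof.
rewrite /J2 stateD sqnormD ?Q2_sym //.
under eq_bigr => k _ do rewrite stateD colD !sqnormD ?Q2_sym ?R22_sym //.
rewrite /slope /hess.
(* Regroup each stage as value, twice the slope term, Hessian term. *)
rewrite (eq_bigr (fun k => (sqnorm (Q2 G (cur k)) (state G u1 u (cur k)) +
   sqnorm (R21 G k) (col k u1) + sqnorm (R22 G k) (col k u)) +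
  ((dot (variation v (cur k)) (Q2 G (cur k) *m state G u1 u (cur k)) +
    dot (col k v) (R22 G k *m col k u)) * 2 +
  (dot (variation v (cur k)) (Q2 G (cur k) *m variation v (cur k)) +
   dot (col k v) (R22 G k *m col k v))))); last by move=> k _; ring.
by rewrite !big_split /= -!mulr_suml big_split /=; field.
Qed.

(** * The Hessian is positive definite *)

Section RiccatiCondition.
Variables (P : 'I_K.+1 -> 'M[R]_n) (ricP : riccati G P).

Lemma riccati_sym k : (P k)^T = P k.
Proof.
have [PK PS _] := ricP; elim/stage_ind_rev: k => [|k IH].
  by rewrite PK Q2_sym.
have symGamma : (Gamma G P k)^T = Gamma G P k.
  by rewrite /Gamma linearD /= !trmx_mul trmxK IH R22_sym mulmxA.
rewrite PS !(linearD, linearN) /= !trmx_mul !trmxK trmx_inv symGamma IH Q2_sym.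
by rewrite !mulmxA.
Qed.

Lemma Gamma_sym k : (Gamma G P k)^T = Gamma G P k.
Proof.
by rewrite /Gamma linearD /= !trmx_mul trmxK riccati_sym R22_sym mulmxA.
Qed.

Lemma Gamma_unit k : Gamma G P k \in unitmx.
Proof. by have [_ _ /(_ k)/posdef_unitmx] := ricP. Qed.

(** Completing the square in the stage control: by the Riccati equation, stage
    cost plus increment of the quadratic function given by [P] leaves only the
    deviation of [v] from the feedback [Lx *m y]. *)
Lemma riccati_completion k (y : 'cV[R]_n) (v : 'cV[R]_m2) :
  dot y (Q2 G (cur k) *m y) + dot v (R22 G k *m v)
    + dot (Adyn G k *m y + B2 G k *m v)
          (P (next k) *m (Adyn G k *m y + B2 G k *m v))
    - dot y (P (cur k) *m y)
  = sqnorm (Gamma G P k) (v - Lx G P k *m y).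
Proof.
have [_ -> _] := ricP; rewrite sqnormE /Lx mulNmx opprK.
set W := invmx _ *m _.
have GW : Gamma G P k *m W = V G P k by rewrite mulKVmx // Gamma_unit.
have -> : Gamma G P k *m (v + W *m y) = Gamma G P k *m v + V G P k *m y.
  by rewrite mulmxDr mulmxA GW.
rewrite !(dotDr (v + _)) !dotDl.
have -> : dot (W *m y) (Gamma G P k *m v) = dot v (V G P k *m y).
  by rewrite dot_sym ?Gamma_sym // mulmxA GW.
have -> : dot y ((Q2 G (cur k) + (Adyn G k)^T *m P (next k) *m Adyn G k
   - (V G P k)^T *m invmx (Gamma G P k) *m V G P k) *m y)
  = dot y (Q2 G (cur k) *m y)
   + dot (Adyn G k *m y) (P (next k) *m (Adyn G k *m y))
   - dot (W *m y) (V G P k *m y).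
  rewrite !mulmxDl mulNmx !dotDr dotNr; congr (_ + _ - _).
    by rewrite -!mulmxA -dot_trmx trmxK.
  rewrite (_ : _ *m y = (V G P k)^T *m (W *m y)); last by rewrite /W !mulmxA.
  by rewrite -dot_trmx trmxK dotC.
have -> : dot v (Gamma G P k *m v) =
   dot v (R22 G k *m v) + dot (B2 G k *m v) (P (next k) *m (B2 G k *m v)).
  by rewrite /Gamma mulmxDl dotDr -!mulmxA -[in X in _ + X = _]dot_trmx trmxK.
have VE :
    dot (B2 G k *m v) (P (next k) *m (Adyn G k *m y)) = dot v (V G P k *m y).
  by rewrite /V -!mulmxA -[RHS]dot_trmx trmxK.
rewrite mulmxDr !dotDr (@dot_sym _ _ _ (Adyn G k *m y) (B2 G k *m v));
  last exact: riccati_sym.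
by rewrite VE; ring.
Qed.

Lemma hess_squares v :
  hess v v = \sum_(k < K) sqnorm (Gamma G P k)
                            (col k v - Lx G P k *m variation v (cur k)).
Proof.
have [PK _ _] := ricP; rewrite /hess.
have := stage_telescope (fun k => dot (variation v k) (P k *m variation v k)).
rewrite variation0 dot0l subr0 PK => <-; rewrite addrC -big_split /=.
apply: eq_bigr => k _; rewrite -riccati_completion variationS.
by rewrite !addrA.
Qed.

(** If all the squares vanish, the variation follows the feedback law from the
    zero initial state; it then stays at 0 and its controls are 0. *)
Lemma hess_gt0 v : v != 0 -> 0 < hess v v.
Proof.
have [_ _ posG] := ricP => vn0.
have ge0 k : 0 <= sqnorm (Gamma G P k)
                   (col k v - Lx G P k *m variation v (cur k)).
  exact: posdef_sqnorm_ge0.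
rewrite lt0r hess_squares sumr_ge0 ?andbT //.
apply: contraNneq vn0 => /eqP; rewrite psumr_eq0 // => /allP zero.
have feedback k : col k v = Lx G P k *m variation v (cur k).
  apply/eqP; rewrite -subr_eq0; apply/negPn/negP => /(posG k).
  by rewrite (eqP (zero k (mem_index_enum k))) ltxx.
have y0 k : variation v k = 0.
  elim/stage_ind: k => [|k IH]; first exact: variation0.
  by rewrite variationS feedback IH !mulmx0 addr0.
apply/eqP/matrixP => i k; have /colP/(_ i) := feedback k.
by rewrite y0 mulmx0 !mxE.
Qed.

End RiccatiCondition.

(** * Stationarity and the costate *)

Definition constr (u1 : strategy R K m1) u k :=
  g2 G k (state G u1 u (cur k)) (col k u1) (col k u).

Definition constr_var v (k : 'I_K) : 'cV[R]_c2 :=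
  M2 G k *m variation v (cur k) + N22 G k *m col k v.

Lemma constrD (u1 : strategy R K m1) u v k :
  constr u1 (u + v) k = constr u1 u k + constr_var v k.
Proof.
rewrite /constr /g2 stateD colD /constr_var !mulmxDr.
set a := _ *m _; set b := _ *m _; set c := _ *m _; set d := _ *m _.
set e := _ *m _.
by apply/colP => i; rewrite !(entryD, entryN); ring.
Qed.

Lemma constr_var_linear a u v k :
  constr_var (a *: u + v) k = a *: constr_var u k + constr_var v k.
Proof.
rewrite /constr_var variation_linear col_linear !mulmxDr -!scalemxAr scalerDr.
by rewrite addrACA.
Qed.

(** The costate-free form of the KKT stationarity condition: the derivative of
    the Lagrangian vanishes in every direction. *)
Definition stationary (u1 : strategy R K m1) u (mu : 'I_K -> 'cV[R]_c2) :=
  forall v, slope u1 u v = \sum_(k < K) dot (mu k) (constr_var v k).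

(** Summation by parts of [dot (variation v k) (p k)]: the costate recursion is
    made so that the state variations cancel in the derivative of the
    Lagrangian, leaving the stage control variations [col k v]. *)
Lemma adjoint_identity (u1 : strategy R K m1) u
    (p : 'I_K.+1 -> 'cV[R]_n) (mu : 'I_K -> 'cV[R]_c2) v :
    p ord_max = Q2 G ord_max *m state G u1 u ord_max ->
    (forall k, p (cur k) = Q2 G (cur k) *m state G u1 u (cur k)
                 + (Adyn G k)^T *m p (next k) - (M2 G k)^T *m mu k) ->
  slope u1 u v - \sum_(k < K) dot (mu k) (constr_var v k) =
  \sum_(k < K) dot (col k v)
    (R22 G k *m col k u + (B2 G k)^T *m p (next k) - (N22 G k)^T *m mu k).
Proof.
move=> pK pS; rewrite /slope -pK.
have := stage_telescope (fun k => dot (variation v k) (p k)).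
rewrite variation0 dot0l subr0 => <-; rewrite -big_split -sumrB /=.
apply: eq_bigr => k _; rewrite pS variationS /constr_var !(dotDl, dotDr, dotNr).
rewrite -!(dotC (_^T *m _)) !dot_trmx !(dotC (p _)).
by ring.
Qed.

(** The stage controls vary independently, so by [adjoint_identity] the
    Lagrangian is stationary exactly when each stage residual is 0; the test
    direction is the residual itself. *)
Lemma stationaryP (u1 : strategy R K m1) u
    (p : 'I_K.+1 -> 'cV[R]_n) (mu : 'I_K -> 'cV[R]_c2) :
    p ord_max = Q2 G ord_max *m state G u1 u ord_max ->
    (forall k, p (cur k) = Q2 G (cur k) *m state G u1 u (cur k)
                 + (Adyn G k)^T *m p (next k) - (M2 G k)^T *m mu k) ->
  stationary u1 u mu <->
  forall k, 0 = R22 G k *m col k u + (B2 G k)^T *m p (next k)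
                - (N22 G k)^T *m mu k.
Proof.
move=> pK pS; have adj v := adjoint_identity v pK pS; split=> [stat k|st0 v].
  pose res j := R22 G j *m col j u + (B2 G j)^T *m p (next j)
                - (N22 G j)^T *m mu j.
  have colE j : col j (\matrix_(i, l) res l i 0) = res j.
    by apply/colP => i; rewrite !mxE.
  have := adj (\matrix_(i, l) res l i 0); rewrite stat subrr.
  rewrite (eq_bigr (fun j => dot (res j) (res j))) => [/esym/eqP|j _].
    rewrite psumr_eq0 => [/allP/(_ k (mem_index_enum k))/eqP/dot_eq0//|j _].
    by rewrite dotE sumr_ge0 // => i _; rewrite -expr2 sqr_ge0.
  by rewrite colE.
apply/eqP; rewrite -subr_eq0 adj big1 // => k _.
by rewrite -st0 dot0r.
Qed.

Lemma KKT_stationary x (u1 : strategy R K m1) u p mu : KKT G x u1 u p mu ->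
  stationary u1 u mu /\ forall k, complementary (mu k) (constr u1 u k).
Proof.
move=> [/dynamicsP xE [pK pS] st compl]; split=> [|k].
  apply/(@stationaryP u1 u p mu); rewrite -?xE // => k.
  by rewrite pS -xE.
by rewrite /constr /g2 -xE; exact: compl.
Qed.

Lemma stationary_KKT (u1 : strategy R K m1) u mu :
    stationary u1 u mu -> (forall k, complementary (mu k) (constr u1 u k)) ->
  exists x p, KKT G x u1 u p mu.
Proof.
move=> stat compl.
have [p [pK pS]] := backward_recursion
  (fun k q => Q2 G (cur k) *m state G u1 u (cur k) + (Adyn G k)^T *m q
              - (M2 G k)^T *m mu k)
  (Q2 G ord_max *m state G u1 u ord_max).
exists (state G u1 u), p; split=> //; first exact/dynamicsP.
exact/(stationaryP pK pS).
Qed.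

(** * Optimality of the follower *)

Section Optimality.
Variables (P : 'I_K.+1 -> 'M[R]_n) (ricP : riccati G P).
Variable u1 : strategy R K m1.

Lemma J2_strictly_convex : strictly_convex (J2 G u1 : 'M[R]_(m2, K) -> R).
Proof.
move=> u v t uv t0 t1; pose w := u - v.
have -> : t *: u + (1 - t) *: v = v + t *: w.
  by rewrite /w scalerBl scale1r scalerBr addrCA.
have uE : u = v + w by rewrite /w addrC subrK.
rewrite uE.
have slopeZ : slope u1 v (t *: w) = t * slope u1 v w.
  have s0 : slope u1 v 0 = 0.
    by have := slope_linear u1 v 1 0 0; rewrite scaler0 addr0 => h; lra.
  by rewrite -[t *: w]addr0 slope_linear s0 addr0.
have hessZ : hess (t *: w) (t *: w) = t ^+ 2 * hess w w.
  by rewrite (ipZl hess_linear) (ipZr hessC hess_linear); ring.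
rewrite !J2_taylor slopeZ hessZ -subr_gt0.
have -> : t * (J2 G u1 v + slope u1 v w + 2^-1 * hess w w) + (1 - t) * J2 G u1 v
   - (J2 G u1 v + t * slope u1 v w + 2^-1 * (t ^+ 2 * hess w w))
   = 2^-1 * (t * (1 - t) * hess w w) by ring.
by rewrite !mulr_gt0 ?invr_gt0 ?subr_gt0 // (hess_gt0 ricP) // subr_eq0.
Qed.

(** At a stationary point the slope towards any feasible [w] is the sum of
    [dot (mu k) (constr u1 w k)], hence nonnegative, so the cost of [w] exceeds
    that of [u] by at least half the Hessian of [w - u]; this gives optimality
    and uniqueness at once. *)
Lemma stationary_optimal u mu : stationary u1 u mu ->
    (forall k, complementary (mu k) (constr u1 u k)) ->
  reaction G u1 = [set u].
Proof.
move=> stat compl.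
have grow w : Omega2 G u1 w ->
    J2 G u1 u + 2^-1 * hess (w - u) (w - u) <= J2 G u1 w.
  move=> feas; rewrite {3}(_ : w = u + (w - u)); last by rewrite addrC subrK.
  rewrite J2_taylor lerD2r lerDl stat; apply: sumr_ge0 => k _.
  have -> : constr_var (w - u) k = constr u1 w k - constr u1 u k.
    have := constrD u1 u (w - u) k; rewrite [u + _]addrC subrK => ->.
    by rewrite [RHS]addrC addKr.
  have [mu0 _ _] := compl k.
  rewrite dotDr dotNr (complementary_dot (compl k)) subr0 dotE.
  apply: sumr_ge0 => i _; rewrite mulr_ge0 //; exact: feas.
have feasu : Omega2 G u1 u by move=> k; have [_ + _] := compl k.
apply/seteqP; split=> [w [feasw optw]|_ ->].
  have := grow w feasw; have := optw u feasu => h1 h2.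
  apply/eqP; rewrite -subr_eq0; apply/negPn/negP => /(hess_gt0 ricP) h3.
  lra.
split=> // w /grow; apply: le_trans; rewrite lerDl mulr_ge0 ?invr_ge0 //.
exact: (ip_ge0 hess_linear (hess_gt0 ricP)).
Qed.

(** In the metric of the Hessian the cost is, up to a constant, half the squared
    distance to its unconstrained minimizer [c], and by Riesz representation
    each scalar constraint has a normal vector; the follower's problem becomes
    the projection of [c] onto a nonempty polyhedron. *)
Lemma stationary_exists : U1 G u1 -> exists u mu,
  stationary u1 u mu /\ forall k, complementary (mu k) (constr u1 u k).
Proof.
move=> [w feas].
have riesz_hess := riesz_representation hessC hess_linear (hess_gt0 ricP).
have [c cE] : exists c, forall v, hess c v = - slope u1 0 v.
  by apply: riesz_hess => t u v; rewrite slope_linear; ring.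
have /choice[a aE] (ki : 'I_K * 'I_c2) :
    exists a, forall v, hess a v = constr_var v ki.1 ki.2 0.
  by apply: riesz_hess => t u v; rewrite constr_var_linear !mxE.
pose b (ki : 'I_K * 'I_c2) := constr u1 0 ki.1 ki.2 0.
have slackE u ki : slack hess a b ki u = constr u1 u ki.1 ki.2 0.
  by have := constrD u1 0 u ki.1; rewrite /slack aE add0r => ->;
    rewrite [RHS]entryD addrC.
have [|lam /= lamP] := polyhedral_projection hessC hess_linear
    (hess_gt0 ricP) (a := a) (b := b) c.
  by exists w => ki; rewrite slackE; exact: feas.
set u := c + _ in lamP; pose mu k : 'cV[R]_c2 := \col_i lam (k, i).
exists u, mu; split=> [v|k]; last first.
  apply/complementaryP => i; have muE : mu k i 0 = lam (k, i) by rewrite mxE.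
  by have := lamP (k, i); rewrite slackE muE.
rewrite -[u]add0r slopeD {1}/u (ipDl hess_linear) cE addrA subrr add0r.
rewrite (ip_suml hess_linear).
rewrite (eq_bigr (fun ki => lam (ki.1, ki.2) * hess (a (ki.1, ki.2)) v));
  last by move=> [k i] _.
rewrite -(pair_bigA _ (fun k i => lam (k, i) * hess (a (k, i)) v)) /=.
apply: eq_bigr => k _; rewrite dotE; apply: eq_bigr => i _.
by rewrite aE; congr (_ * _); rewrite [RHS]mxE.
Qed.

End Optimality.

(** * Eliminating the follower's control and the costate *)

Section Reduction.
Variables (P : 'I_K.+1 -> 'M[R]_n) (ricP : riccati G P).
Variables (x p : 'I_K.+1 -> 'cV[R]_n) (u1 : strategy R K m1)
  (u : strategy R K m2) (mu : 'I_K -> 'cV[R]_c2) (zeta : 'I_K.+1 -> 'cV[R]_n).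
Hypothesis pE : forall k, p k = P k *m x k + zeta k.

Definition response (k : 'I_K) : 'cV[R]_m2 :=
  Lx G P k *m x (cur k) + Lu G P k *m col k u1 + Lzeta G P k *m zeta (next k)
  + Lmu G P k *m mu k.

(** The response formula with the inverse of [Gamma] cleared. *)
Lemma Gamma_response k : Gamma G P k *m response k =
  - ((B2 G k)^T *m (P (next k) *m (Adyn G k *m x (cur k) + B1 G k *m col k u1)
                    + zeta (next k)))
  + (N22 G k)^T *m mu k.
Proof.
have unitG := Gamma_unit ricP k.
rewrite /response /Lx /Lu /Lzeta /Lmu !mulmxDr !mulNmx !mulmxN.
rewrite !mulmxA mulmxV // -!mulmxA.
by rewrite !mul1mx /V !mulmxA !opprD.
Qed.

(** With [p] written as [P x + zeta] and the next state eliminated by the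
    dynamics, the stationarity residual is [Gamma] times the deviation of the
    control from the response, and [Gamma] is invertible. *)
Lemma stationarity_response k :
    x (next k) =
      Adyn G k *m x (cur k) + B1 G k *m col k u1 + B2 G k *m col k u ->
  0 = R22 G k *m col k u + (B2 G k)^T *m p (next k) - (N22 G k)^T *m mu k
  <-> col k u = response k.
Proof.
move=> xS; have unitG := Gamma_unit ricP k.
have -> : R22 G k *m col k u + (B2 G k)^T *m p (next k) - (N22 G k)^T *m mu k
    = Gamma G P k *m (col k u - response k).
  rewrite mulmxBr Gamma_response pE xS /Gamma mulmxDl !mulmxDr !mulmxA.
  by apply/colP => i; rewrite !(entryD, entryN); ring.
split=> [/(f_equal (mulmx (invmx (Gamma G P k))))|->]; last first.
  by rewrite subrr mulmx0.
by rewrite mulmx0 mulKmx // => /esym/eqP; rewrite subr_eq0 => /eqP.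
Qed.

Lemma closed_loop_state k :
  Adyn G k *m x (cur k) + B1 G k *m col k u1 + B2 G k *m response k
  = Abar G P k *m x (cur k) + Bbar G P k *m col k u1 + Cbar G P k *m mu k
    + Dbar G P k *m zeta (next k).
Proof.
rewrite /response /Abar /Bbar /Cbar /Dbar !mulmxDl !mulmxDr !mulmxA.
by apply/colP => i; rewrite !(entryD, entryN); ring.
Qed.

Lemma closed_loop_constraint k :
  M2 G k *m x (cur k) + N21 G k *m col k u1 + N22 G k *m response k + r2 G k
  = E2 G P k *m x (cur k) + S2 G P k *m col k u1 + W2 G P k *m zeta (next k)
    + U2 G P k *m mu k + r2 G k.
Proof.
rewrite /response /E2 /S2 /W2 /U2 !mulmxDl !mulmxDr !mulmxA.
by apply/colP => i; rewrite !(entryD, entryN); ring.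
Qed.

(** Substituting [p = P x + zeta] and the response into the costate recursion,
    the terms in [x] are those of the Riccati equation, so they add up to
    [P (cur k) *m x (cur k)]. *)
Lemma closed_loop_costate k :
    x (next k) =
      Adyn G k *m x (cur k) + B1 G k *m col k u1 + B2 G k *m response k ->
  Q2 G (cur k) *m x (cur k) + (Adyn G k)^T *m p (next k) - (M2 G k)^T *m mu k
  = P (cur k) *m x (cur k)
    + ((Abar G P k)^T *m zeta (next k) + Fbar G P k *m col k u1
       + Gbar G P k *m mu k).
Proof.
move=> xS; have [_ -> _] := ricP.
have VT : (V G P k)^T = (Adyn G k)^T *m P (next k) *m B2 G k.
  by rewrite /V !trmx_mul trmxK riccati_sym // mulmxA.
have AbarT : (Abar G P k)^T = (Adyn G k)^T + (V G P k)^T *m Lzeta G P k.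
  rewrite /Abar /Lx /Lzeta linearD /= trmx_mul linearN /= trmx_mul trmx_inv.
  by rewrite Gamma_sym // mulNmx mulmxN mulmxA.
rewrite pE xS AbarT /Fbar /Gbar /response !mulmxDr !mulmxDl.
rewrite !(mulmxA (B2 G k)) !(mulmxA (P (next k))) !(mulmxA (Adyn G k)^T).
rewrite !mulNmx !mulmxA -!VT /Lx !mulmxN !mulNmx !mulmxA.
by apply/colP => i; rewrite !(entryD, entryN); ring.
Qed.

(** Both directions go through the response formula: it follows from
    stationarity on one side, is assumed on the other, and once it holds the
    remaining conditions match stage by stage. *)
Lemma KKT_reduced : KKT G x u1 u p mu <->
  response_formula G P x u1 u zeta mu /\ reduced_system G P x u1 zeta mu.
Proof.
have [PK _ _] := ricP.
split=> [[[x0 xS] [pK pS] st compl]|[resp [[x0 xS] [zK zS] compl]]].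
  have resp k : col k u = response k by apply/stationarity_response.
  have xS' k : x (next k) = Adyn G k *m x (cur k) + B1 G k *m col k u1
                            + B2 G k *m response k by rewrite -resp.
  split=> //; split.
  - by split=> // k; rewrite -closed_loop_state.
  - split=> [|k].
      by apply: (addrI (P ord_max *m x ord_max)); rewrite -pE pK PK addr0.
    by apply: (addrI (P (cur k) *m x (cur k)));
      rewrite -pE pS closed_loop_costate.
  - by move=> k; rewrite -closed_loop_constraint -resp.
have resp' k : col k u = response k by exact: resp.
have xS' k : x (next k) = Adyn G k *m x (cur k) + B1 G k *m col k u1
                          + B2 G k *m response k.
  by rewrite closed_loop_state.
have xS'' k : x (next k) = Adyn G k *m x (cur k) + B1 G k *m col k u1
                          + B2 G k *m col k u by rewrite resp'.
split=> // [|k|k].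
- split=> [|k]; first by rewrite pE zK PK addr0.
  by rewrite closed_loop_costate // -zS -pE.
- exact/stationarity_response.
- by rewrite resp' closed_loop_constraint.
Qed.

End Reduction.
End Game.

Theorem lemma1 (R : realType) (K n m1 m2 c2 : nat) (hK : (1 <= K)%N)
    (G : game R K n m1 m2 c2) (hreg : regularity G)
    (P : 'I_K.+1 -> 'M[R]_n) (hric : riccati G P)
    (u1 : strategy R K m1) (hu1 : U1 G u1) :
  [/\ strictly_convex (J2 G u1 : 'M[R]_(m2, K) -> R),
      exists u2 : strategy R K m2, reaction G u1 = [set u2],
      forall u2 : strategy R K m2,
        reaction G u1 u2 <->
        exists (x p : 'I_K.+1 -> 'cV[R]_n) (mu : 'I_K -> 'cV[R]_c2),
          KKT G x u1 u2 p mu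
    & forall (x p : 'I_K.+1 -> 'cV[R]_n) (u2 : strategy R K m2)
             (mu : 'I_K -> 'cV[R]_c2),
        let zeta := fun k : 'I_K.+1 => p k - P k *m x k in
        (KKT G x u1 u2 p mu <->
          [/\ reaction G u1 = [set u2],
              response_formula G P x u1 u2 zeta mu
            & reduced_system G P x u1 zeta mu]) /\
        (response_formula G P x u1 u2 zeta mu ->
         reduced_system G P x u1 zeta mu -> reaction G u1 = [set u2])].
Proof.
have KKT_opt x p u2 mu : KKT G x u1 u2 p mu -> reaction G u1 = [set u2].
  move=> /KKT_stationary[stat' compl'].
  exact: stationary_optimal hric _ _ _ stat' compl'.
have [u [mu [stat compl]]] := stationary_exists hric hu1.
have uopt := stationary_optimal hric stat compl.
split=> [||u2|x p u2 nu zeta].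
- exact: J2_strictly_convex hric _.
- by exists u.
- split=> [|[x [p [nu /KKT_opt->]]]//]; rewrite uopt => ->.
  by have [x [p kkt]] := stationary_KKT stat compl; exists x, p, mu.
- have pE k : p k = P k *m x k + zeta k by rewrite /zeta addrC subrK.
  have red := KKT_reduced hric u1 u2 nu pE.
  split=> [|resp sys]; last by apply: (KKT_opt x p u2 nu); apply/red.
  split=> [kkt|[_ resp sys]]; last exact/red.
  by have /red[] := kkt; split=> //; exact: KKT_opt kkt.
Qed.
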